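(* For any discrete group $G$, the pair $(\beta G/\Theta,\mathfrak h_\Theta)$ is the universal chartification of $G$, where $\Theta$ is the least closed congruence on $\beta G$ such that $\{(u,1_G):u\in\beta G\text{ is idempotent}\}\subset\Theta$, and $\mathfrak h_\Theta:G\to\beta G/\Theta$ is given by $\mathfrak h_\Theta(x)=[x]_\Theta$.
   Context: All topological spaces are assumed Hausdorff. A right topological semigroup (group) is a semigroup (group) $S$ with a topology such that for each $s\in S$ the right shift $x\mapsto xs$ is continuous. For such $S$, its topological center is $\Lambda(S)=\{s\in S:\text{the left shift } x\mapsto sx\text{ is continuous}\}$. A right topological group $G$ is admissible if $\Lambda(G)$ is dense in $G$. A chart group is a compact Hausdorff admissible right topological group. For a discrete semigroup $S$, $\beta S$ is the Stone-Čech compactification of $S$: the set of all ultrafilters on $S$ with the topology given by the base of sets $\{u\in\beta S:A\in u\}$, $A\subseteq S$; each $x\in S$ is identified with the principal ultrafilter $\{A\subseteq S:x\in A\}$. The operation of $S$ extends to $\beta S$ by: $A\in uv$ iff $\{s\in S:\{t\in S: st\in A\}\in v\}\in u$; with it $\beta S$ is a compact right topological semigroup. An ultrafilter $u\in\beta S$ is idempotent if $uu=u$. A congruence on a semigroup $S$ is an equivalence relation $\rho$ such that $(a_1,b_1),(a_2,b_2)\in\rho$ imply $(a_1a_2,b_1b_2)\in\rho$; $[x]_\rho$ is the $\rho$-class of $x$ and $S/\rho$ is the quotient semigroup, with operation $[x]_\rho[y]_\rho=[xy]_\rho$ and the quotient topology. A congruence on $\beta G$ is closed if it is a closed subset of $\beta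 G\times\beta G$; intersections of closed congruences are closed congruences, so the least closed congruence containing a given relation exists. A universal chartification of a right topological group $G$ is a pair $(\mathfrak cG,c)$ consisting of a chart group $\mathfrak cG$ and a continuous homomorphism $c:G\to\mathfrak cG$ such that: (i) $c(G)$ is dense in $\mathfrak cG$; (ii) $c(G)\subseteq\Lambda(\mathfrak cG)$; (iii) for each chart group $H$ and continuous homomorphism $f:G\to H$ with $f(G)\subseteq\Lambda(H)$ there exists a continuous homomorphism $g:\mathfrak cG\to H$ such that $f=g\circ c$. *)

(* Defs.v *)
From HB Require Import structures.
From mathcomp Require Import all_boot.
From mathcomp Require Import all_classical topology.

Set Implicit Arguments.
Unset Strict Implicit.
Unset Printing Implicit Defensive.

Local Open Scope classical_set_scope.
Local Open Scope group_scope.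
Local Open Scope quotient_scope.

(* These joins carry data only: no compatibility between the operation and the
   topology is assumed. *)
#[short(type="topSemigroupType")]
HB.structure Definition TopSemigroup := {S of Semigroup S & Topological S}.

#[short(type="topGroupType")]
HB.structure Definition TopGroup := {G of Group G & Topological G}.

#[short(type="discreteGroupType")]
HB.structure Definition DiscreteGroup := {G of Group G & DiscreteTopology G}.

(* Being a group is a property of a semigroup here, so that it can be asserted
   of a quotient semigroup, which carries no chosen unit or inverse. *)
Definition semigroup_is_group (S : semigroupType) : Prop :=
  exists e : S, [/\ left_id e *%g, right_id e *%g
    & forall x : S, exists y : S, y * x = e /\ x * y = e].

Definition right_topological (S : topSemigroupType) : Prop :=
  forall s : S, continuous (fun x : S => x * s).

Definition topological_center (S : topSemigroupType) : set S :=
  [set s : S | continuous (fun x : S => s * x)].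
Arguments topological_center : clear implicits.

Definition admissible (S : topSemigroupType) : Prop :=
  dense (topological_center S).

Record chart_group (S : topSemigroupType) : Prop := ChartGroup {
  chart_is_group : semigroup_is_group S;
  chart_right_topological : right_topological S;
  chart_hausdorff : hausdorff_space S;
  chart_compact : compact [set: S];
  chart_admissible : admissible S }.

Record universal_chartification (G : topGroupType) (C : topSemigroupType)
    (c : G -> C) : Prop := UniversalChartification {
  uc_chart_group : chart_group C;
  uc_continuous : continuous c;
  uc_morph : {morph c : x y / x * y};
  uc_dense : dense (range c);
  uc_center : range c `<=` topological_center C;
  uc_universal : forall (H : topSemigroupType) (f : G -> H),
    chart_group H -> continuous f -> {morph f : x y / x * y} ->
    range f `<=` topological_center H ->
    exists g : C -> H,
      [/\ continuous g, {morph g : x y / x * y} & f = g \o c] }.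

Record is_congruence (S : semigroupType) (rho : set (S * S)) : Prop :=
  IsCongruence {
    congr_refl : forall x, rho (x, x);
    congr_sym : forall x y, rho (x, y) -> rho (y, x);
    congr_trans : forall x y z, rho (x, y) -> rho (y, z) -> rho (x, z);
    congr_mul : forall a1 b1 a2 b2,
      rho (a1, b1) -> rho (a2, b2) -> rho (a1 * a2, b1 * b2) }.

Record congruence (S : semigroupType) := Congruence {
  congr_set :> S * S -> Prop;
  congrP : is_congruence congr_set }.

Section CongruenceQuotient.
Variables (S : topSemigroupType) (rho : congruence S).

Let rhoP := congrP rho.

Definition congr_rel : rel S := fun x y => `[< rho (x, y) >].

Lemma congr_rel_refl : reflexive congr_rel.
Proof. by move=> x; apply/asboolP; exact: (congr_refl rhoP). Qed.

Lemma congr_rel_sym : symmetric congr_rel.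
Proof. by move=> x y; apply/asboolP/asboolP; exact: (congr_sym rhoP). Qed.

Lemma congr_rel_trans : transitive congr_rel.
Proof.
move=> y x z /asboolP xy /asboolP yz; apply/asboolP.
exact: (congr_trans rhoP) xy yz.
Qed.

Definition congr_equiv : equiv_rel S :=
  EquivRel congr_rel congr_rel_refl congr_rel_sym congr_rel_trans.

Definition congr_quot : Type := quotient_topology {eq_quot congr_equiv}.

HB.instance Definition _ := Topological.on congr_quot.
HB.instance Definition _ := Quotient.on congr_quot.

Definition congr_class (x : S) : congr_quot := \pi_congr_quot x.

Lemma congr_classP (x y : S) : congr_class x = congr_class y <-> rho (x, y).
Proof.
split=> [xy|xy].
  have /eqmodP/asboolP // : x = y %[mod {eq_quot congr_equiv}] := xy.
by have /eqmodP : congr_equiv x y by exact/asboolP.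
Qed.

Definition congr_quot_mul (a b : congr_quot) : congr_quot :=
  congr_class (repr a * repr b).

Lemma congr_repr (x : S) : rho (repr (congr_class x), x).
Proof. by apply/congr_classP; rewrite /congr_class reprK. Qed.

Lemma congr_quot_mulE (x y : S) :
  congr_quot_mul (congr_class x) (congr_class y) = congr_class (x * y).
Proof. by apply/congr_classP/(congr_mul rhoP); exact: congr_repr. Qed.

Lemma congr_quot_mulA : associative congr_quot_mul.
Proof.
move=> a b c; rewrite -[a]reprK -[b]reprK -[c]reprK.
by rewrite -!/(congr_class _) !congr_quot_mulE mulgA.
Qed.

HB.instance Definition _ := isSemigroup.Build congr_quot congr_quot_mulA.

End CongruenceQuotient.

Section ClosedCongruence.
Variable S : topSemigroupType.

Definition closed_congruence (rho : set (S * S)) : Prop :=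
  is_congruence rho /\ closed rho.

Lemma smallest_closed_congruenceP (R : set (S * S)) :
  closed_congruence (smallest closed_congruence R).
Proof.
split; last by apply: closed_bigI => rho [[_ ?]].
split.
- by move=> x rho [[[rr _ _ _] _] _]; exact: rr.
- by move=> x y xy rho rhoP; apply: (congr_sym rhoP.1.1); exact: xy.
- move=> x y z xy yz rho rhoP.
  by apply: (congr_trans rhoP.1.1); [exact: xy|exact: yz].
- move=> a1 b1 a2 b2 h1 h2 rho rhoP.
  by apply: (congr_mul rhoP.1.1); [exact: h1|exact: h2].
Qed.

Definition least_closed_congruence (R : set (S * S)) : congruence S :=
  Congruence (smallest_closed_congruenceP R).1.

End ClosedCongruence.

(* The Stone-Cech compactification of T with its discrete topology. *)
Record stone_cech (T : Type) := StoneCech {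
  ultra_sets :> set T -> Prop;
  ultra_setsP : UltraFilter ultra_sets }.

#[global] Existing Instance ultra_setsP.

#[global] Instance stone_cech_proper (T : Type) (u : stone_cech T) :
  ProperFilter (ultra_sets u).
Proof. exact: ultra_proper. Qed.

Lemma stone_cech_inj (T : Type) (u v : stone_cech T) :
  ultra_sets u = ultra_sets v -> u = v.
Proof.
case: u v => [u uP] [v vP] /= uv; rewrite {}uv in uP *.
by congr StoneCech; exact: Prop_irrelevance.
Qed.

Lemma ultra_setC (T : Type) (u : stone_cech T) (A : set T) : u (~` A) <-> ~ u A.
Proof.
split=> [uC uA|nuA]; last by have [] := in_ultra_setVsetC A (ultra_setsP u).
have uAC : u (A `&` ~` A) by exact: filterI.
by have [x []] := filter_ex uAC.
Qed.

Lemma ultra_filterP (T : Type) (F : set_system T) : ProperFilter F ->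
  (forall A, F A \/ F (~` A)) -> UltraFilter F.
Proof.
move=> PF FC; split=> // H PH FH; apply/seteqP; split=> // A HA.
have [//|/FH HC] := FC A.
have HAC : H (A `&` ~` A) by exact: filterI.
by have [x []] := filter_ex HAC.
Qed.

Section StoneCechTopology.
Variable T : Type.

HB.instance Definition _ := gen_eqMixin (stone_cech T).
HB.instance Definition _ := gen_choiceMixin (stone_cech T).

Definition stone_cech_base (A : set T) : set (stone_cech T) := [set u | u A].

Let base_cover :
  \bigcup_(A in [set: set T]) stone_cech_base A = [set: stone_cech T].
Proof. by apply/seteqP; split=> // u _; exists setT => //; exact: filterT. Qed.

Let base_join (A B : set T) (u : stone_cech T) :
  [set: set T] A -> [set: set T] B ->
  stone_cech_base A u -> stone_cech_base B u ->
  exists C, [/\ [set: set T] C, stone_cech_base C u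
    & stone_cech_base C `<=` stone_cech_base A `&` stone_cech_base B].
Proof.
move=> _ _ uA uB; exists (A `&` B); split=> //; first exact: (@filterI _ u).
by move=> v /= vAB; split; apply: (@filterS _ v _ (A `&` B)) vAB => x [].
Qed.

HB.instance Definition _ :=
  isBaseTopological.Build (stone_cech T) base_cover base_join.

Definition principal_ultra (x : T) : stone_cech T :=
  StoneCech (principal_filter_ultra x).

End StoneCechTopology.

Section StoneCechSemigroup.
Variable S : semigroupType.
Implicit Types u v w : stone_cech S.

Definition ultra_mul_sets u v : set_system S :=
  [set A | u [set s | v [set t | A (s * t)]]].

Lemma ultra_mul_subproof u v : UltraFilter (ultra_mul_sets u v).
Proof.
apply: ultra_filterP.
  split; last split; rewrite /ultra_mul_sets /=.
  - by move=> /filter_ex[s] /filter_ex[].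
  - by apply: filterE => s; exact: filterE.
  - move=> A B uA uB; apply: (@filterS2 _ u _ _ _ _ _ uA uB) => s vA vB.
    exact: (@filterI _ v).
  - move=> A B AB uA; apply: (@filterS _ u _ _ _ _ uA) => s vA.
    by apply: (@filterS _ v _ _ _ _ vA) => t; exact: AB.
move=> A; have [uA|/ultra_setC uA] :=
  pselect (u [set s | v [set t | A (s * t)]]); first by left.
by right; apply: (@filterS _ u _ _ _ _ uA) => s /= /ultra_setC.
Qed.

Definition ultra_mul u v : stone_cech S := StoneCech (ultra_mul_subproof u v).

Lemma ultra_mulA : associative ultra_mul.
Proof.
move=> u v w; apply: stone_cech_inj; apply/funext => A.
rewrite /= /ultra_mul_sets /=; congr (ultra_sets u _); apply/funext => s /=.
congr (ultra_sets v _); apply/funext => t /=.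
by congr (ultra_sets w _); apply/funext => r /=; rewrite mulgA.
Qed.

HB.instance Definition _ := isSemigroup.Build (stone_cech S) ultra_mulA.

End StoneCechSemigroup.

Definition Theta (G : groupType) : congruence (stone_cech G) :=
  least_closed_congruence
    [set p : stone_cech G * stone_cech G |
      p.1 * p.1 = p.1 /\ p.2 = principal_ultra 1].

Definition h_Theta (G : groupType) (x : G) : congr_quot (Theta G) :=
  congr_class (Theta G) (principal_ultra x).

(* Main.v *)
Require Import Defs.
From mathcomp Require Import all_boot.
From mathcomp Require Import all_classical topology.

(** The quotient of [beta G] by [Theta] is a chart group because idempotents
    are the only obstruction to being a group. [beta G] is a compact Hausdorff
    right topological monoid, and for every [u] the left ideal [beta G * u] is
    closed, so it contains an idempotent [v * u] by the Ellis-Numakura lemma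
    ([ellis_numakura]). Modulo [Theta] that idempotent becomes the unit, so
    every class has a left inverse, and a monoid with left inverses is a group
    ([congr_quot_Theta_group]). The quotient is Hausdorff because [Theta] is
    closed and [beta G] is compact: the projection is then a closed map
    ([congr_class_closed_map]), and closed images of compact Hausdorff spaces
    are Hausdorff ([hausdorff_closed_image]). Left shifts by principal
    ultrafilters are continuous on [beta G], hence on the quotient, where they
    come from the dense image of [G]; this gives admissibility.

    For universality, a homomorphism [f] from [G] into the topological center
    of a chart group [H] extends to [F u], the limit of [f] along [u]
    ([stone_cech_extension]). The extension is again a homomorphism: right
    shifts of [H] are continuous everywhere, and the left shifts needed are
    those by elements [f s], which are continuous by the assumption on the
    range of [f] ([stone_cech_morph]). The kernel of [F] is a closed
    congruence, and it identifies every idempotent with the unit since a group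
    has a single idempotent. By minimality it contains [Theta], so [F] factors
    through the quotient. *)

Set Implicit Arguments.
Unset Strict Implicit.
Unset Printing Implicit Defensive.

Local Open Scope classical_set_scope.
Local Open Scope group_scope.

(** * Compact Hausdorff spaces *)

Lemma closed_equalizer (X Y : topologicalType) (f g : X -> Y) :
  hausdorff_space Y -> continuous f -> continuous g ->
  closed [set x | f x = g x].
Proof.
rewrite open_hausdorff => hY cf cg x clx; apply: contrapT => /eqP /hY.
case=> -[A B] /= [/set_mem Afx /set_mem Bgx] [oA oB /eqP AB0].
have nA : nbhs x (f @^-1` A) by apply: cf; exact: open_nbhs_nbhs.
have nB : nbhs x (g @^-1` B) by apply: cg; exact: open_nbhs_nbhs.
have [y [/= fgy [Afy Bgy]]] := clx _ (filterI nA nB).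
have : (A `&` B) (f y) by split=> //; rewrite /= fgy.
by rewrite AB0.
Qed.

Lemma continuous_closed_map (X Y : topologicalType) (f : X -> Y) (C : set X) :
  compact [set: X] -> hausdorff_space Y -> continuous f -> closed C ->
  closed (f @` C).
Proof.
move=> cX hY cf clC; apply: compact_closed => //; apply: continuous_compact.
  exact: continuous_subspaceT.
exact: subclosed_compact clC cX _.
Qed.

(** Fibres of [f] are closed, so two of them have disjoint neighbourhoods by
    normality; since [f] is closed, a neighbourhood of a fibre contains the
    preimage of a neighbourhood of the point below it. *)
Lemma hausdorff_closed_image (X Y : topologicalType) (f : X -> Y) :
  compact [set: X] -> hausdorff_space X -> continuous f ->
  (forall y, exists x, f x = y) ->
  (forall C, closed C -> closed (f @` C)) -> hausdorff_space Y.
Proof.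
move=> cX hX cf surjf clf.
have clfib y : closed (f @^-1` [set y]).
  move/continuous_closedP: cf; apply; have [x <-] := surjf y.
  rewrite -image_set1; apply: clf; apply: accessible_closed_set1.
  exact: hausdorff_accessible.
(* The points whose whole fibre lies in [O] form an open set. *)
have core O y : open O -> f @^-1` [set y] `<=` O -> nbhs y (~` (f @` (~` O))).
  move=> oO fO; apply: open_nbhs_nbhs; split.
    by apply: closed_openC; apply: clf; exact: open_closedC.
  by move=> [x nOx fxy]; apply: nOx; exact: fO.
move=> p q pq; apply: contrapT => npq.
have fibB : set_nbhs (f @^-1` [set p]) (~` (f @^-1` [set q])).
  apply/set_nbhsP; exists (~` (f @^-1` [set q])); split => //.
    exact: closed_openC.
  by move=> x /= -> qp; exact: npq.
have [D /set_nbhsP[O [oO pO OD]] DB] :=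
  compact_normal hX cX (clfib p) fibB.
have nq : nbhs q (~` (f @` closure D)).
  rewrite -[closure D]setCK; apply: core.
    exact/closed_openC/closed_closure.
  by move=> x /= fxq /DB /=; exact.
have [y [nO nD]] := pq _ _ (core O p oO pO) nq.
have [x fxy] := surjf y.
have [Ox|nOx] := pselect (O x); last by apply: nO; exists x.
by apply: nD; exists x => //; exact/subset_closure/OD.
Qed.

(** * Idempotents in compact right topological semigroups *)

(** The finite intersection property for the decreasing chain of the closed
    sets [T `\` U]. Working with the removed sets [U], ordered upwards, matches
    the form of Zorn's lemma that asks for unions of chains. *)
Lemma compact_chain_setD (X : topologicalType) (T : set X) (F : set (set X)) :
  compact T -> T !=set0 -> total_on F subset ->
  (forall U, F U -> closed (T `\` U) /\ T `\` U !=set0) ->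
  T `\` \bigcup_(U in F) U !=set0.
Proof.
move=> cT T0 totF FP.
have [->|/set0P[U0 FU0]] := eqVneq F set0; first by rewrite bigcup_set0 setD0.
pose G := filter_from F (fun U => T `\` U).
have GP : ProperFilter G.
  apply: filter_from_proper; last by move=> U /FP[].
  apply: filter_from_filter; first by exists U0.
  move=> U V FU FV; have [UV|VU] := totF _ _ FU FV.
    by exists V => // x [Tx nVx]; split; split=> // /UV.
  by exists U => // x [Tx nUx]; split; split=> // /VU.
have GT : G T by exists U0 => // x [].
have [x [Tx clx]] := cT G GP GT.
exists x; split=> // -[U FU Ux].
have [clU _] := FP _ FU.
have [] : (T `\` U) x by apply: clU => B nB; apply: clx => //; exists U.
by [].
Qed.

(** A minimal closed subsemigroup [M] of [T] consists of one idempotent. For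
    [a] in [M], [M * a] is a closed subsemigroup of [M], hence all of [M], so
    some [x] in [M] satisfies [x * a = a]. The elements that fix [a] in this
    way form another closed subsemigroup, again all of [M], so they include
    [a] itself. *)
Lemma ellis_numakura (S : topSemigroupType) (T : set S) :
  right_topological S -> compact [set: S] -> hausdorff_space S ->
  closed T -> T !=set0 -> (forall x y, T x -> T y -> T (x * y)) ->
  exists2 e, T e & e * e = e.
Proof.
move=> rS cS hS clT T0 mulT.
pose subsemi (U : set S) := [/\ closed U, U !=set0 &
  forall x y, U x -> U y -> U (x * y)].
have [V [subM maxV]] : exists V, subsemi (T `\` V) /\
    forall W, V `<` W -> ~ subsemi (T `\` W).
  apply: (@Zorn_bigcup _ (fun V => subsemi (T `\` V))) => F FP totF.
  split.
  - rewrite setDE setC_bigcup.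
    have [->|F0] := eqVneq F set0; first by rewrite bigcap_set0 setIT.
    rewrite -bigcapIr; last exact/set0P.
    by apply: closed_bigI => U /FP[]; rewrite setDE.
  - apply: compact_chain_setD => //; first exact: subclosed_compact clT cS _.
    by move=> U /FP[].
  - move=> x y [Tx nx] [Ty ny]; split; first exact: mulT.
    move=> [U FU Uxy]; have [_ _ mulU] := FP _ FU.
    have [] := mulU x y; [split=> // Ux|split=> // Uy|by []].
      by apply: nx; exists U.
    by apply: ny; exists U.
(* [M] is minimal because [V] is maximal. *)
pose M := T `\` V.
have [clM [a Ma] mulM] : subsemi M by [].
have minM N : N `<=` M -> subsemi N -> M `<=` N.
  move=> NM sN x Mx; apply: contrapT => nNx.
  apply: (maxV (~` N)).
    split; first by move=> y Vy /NM [].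
    by move=> /(_ x nNx) Vx; case: Mx.
  suff -> : T `\` ~` N = N by [].
  by rewrite setDE setCK; apply/setIidPr => y /NM[].
exists a; first by case: Ma.
have Mafix : M `<=` [set x | M x /\ x * a = a].
  have MMa : M `<=` [set x * a | x in M].
    apply: minM; first by move=> _ [x Mx <-]; exact: mulM.
    split; first exact: continuous_closed_map.
      by exists (a * a), a.
    move=> _ _ [x Mx <-] [y My <-]; exists (x * a * y); last by rewrite !mulgA.
    exact: mulM (mulM _ _ Mx Ma) My.
  apply: minM; first by move=> x [].
  split.
  - apply: closedI => //; apply: closed_equalizer => //; exact: cst_continuous.
  - by have [x Mx xa] := MMa a Ma; exists x.
  - move=> x y [Mx xa] [My ya]; split; first exact: mulM.
    by rewrite -mulgA ya.
by have [] := Mafix a Ma.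
Qed.

(** * The Stone-Cech compactification *)

Section StoneCech.
Variable T : Type.
Implicit Types (u v : stone_cech T) (A : set T).

Lemma open_stone_cech_base A : open (stone_cech_base A).
Proof. by exists [set A] => //; rewrite bigcup_set1. Qed.

Lemma nbhs_stone_cechP u (W : set (stone_cech T)) :
  nbhs u W <-> exists2 A, u A & stone_cech_base A `<=` W.
Proof.
split=> [|[A uA AW]].
  rewrite nbhsE => -[O [[D' _ <-] [A D'A uA]] OW].
  by exists A => // v vA; apply: OW; exists A.
apply: filterS AW _; apply: open_nbhs_nbhs; split=> //.
exact: open_stone_cech_base.
Qed.

Lemma continuous_to_stone_cech (X : topologicalType) (f : X -> stone_cech T) :
  (forall A, open (f @^-1` stone_cech_base A)) -> continuous f.
Proof.
move=> fo x W /nbhs_stone_cechP[A uA AW].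
apply: (@filterS _ _ _ (f @^-1` stone_cech_base A)) => [y /AW //|].
by apply: open_nbhs_nbhs; split; first exact: fo.
Qed.

Lemma stone_cech_hausdorff : hausdorff_space (stone_cech T).
Proof.
move=> u v uv; apply/esym/stone_cech_inj/max_filter => A uA.
apply: contrapT => /ultra_setC vA.
have nu : nbhs u (stone_cech_base A) by apply/nbhs_stone_cechP; exists A.
have nv : nbhs v (stone_cech_base (~` A)).
  by apply/nbhs_stone_cechP; exists (~` A).
by have [w [wA /ultra_setC]] := uv _ _ nu nv.
Qed.

(** An ultrafilter [F] of ultrafilters converges to the ultrafilter of the sets
    [A] that belong to [F]-almost every ultrafilter. *)
Lemma stone_cech_compact : compact [set: stone_cech T].
Proof.
rewrite compact_ultra => F FU _.
have uU : UltraFilter [set A | F (stone_cech_base A)].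
  apply: ultra_filterP.
    split; last split => /=.
    - move=> F0; have [v v0] := filter_ex (F0 : F (stone_cech_base set0)).
      by have [] := filter_ex (v0 : v set0).
    - by apply: filterE => v; exact: filterT.
    - move=> A B FA FB; apply: (@filterS2 _ F _ _ _ _ _ FA FB) => v.
      exact: (@filterI _ v).
    - move=> A B AB FA; apply: (@filterS _ F _ _ _ _ FA) => v.
      exact: (@filterS _ v).
  move=> A; have [] := in_ultra_setVsetC (stone_cech_base A) FU; first by left.
  by move=> FA; right; apply: filterS FA => v /ultra_setC.
exists (StoneCech uU); split=> // W /nbhs_stone_cechP[A uA].
by move=> AW; apply: (@filterS _ F _ _ _ AW).
Qed.

Lemma principal_ultra_dense : dense (range (@principal_ultra T)).
Proof.
move=> O [u Ou] oO.
have /nbhs_stone_cechP[A uA AO] : nbhs u O by exact: open_nbhs_nbhs.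
have [x Ax] := filter_ex uA.
by exists (principal_ultra x); split; [apply/AO/principal_filterP|exists x].
Qed.

(** [F u] is the limit of [f] along [u]. Continuity uses regularity of [K]: if
    [V] is a neighbourhood of [F u] with closure inside [W], then every
    ultrafilter containing the preimage of [V] is sent into the closure of
    [V]. The convergence clause is kept in the conclusion because it is what
    makes algebraic identities pass from [f] to [F]. *)
Lemma stone_cech_extension (K : topologicalType) (f : T -> K) :
  compact [set: K] -> hausdorff_space K ->
  exists F : stone_cech T -> K, [/\ continuous F,
    (forall u, fmap f (ultra_sets u) --> F u) &
    (forall x, F (principal_ultra x) = f x)].
Proof.
move=> cK hK.
have fcvg u : exists p : K, fmap f (ultra_sets u) --> p.
  have fu : UltraFilter (fmap f (ultra_sets u)).
    apply: ultra_filterP => A.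
    by have [] := in_ultra_setVsetC (f @^-1` A) (ultra_setsP u); [left|right].
  have := cK; rewrite compact_ultra => /(_ _ fu filterT) [p [_ fp]].
  by exists p.
have [F Fcvg] := choice fcvg.
exists F; split=> // [u W|x].
  move/(compact_regular hK cK filterT) => [V VF VW].
  apply/nbhs_stone_cechP; exists (f @^-1` V); first exact: Fcvg.
  move=> v vV; apply: VW => B /Fcvg vB.
  have [x [Vx Bx]] := filter_ex (@filterI _ v _ _ _ vV vB).
  by exists (f x).
have fx := fmap_proper_filter f (principal_filter_proper x).
apply: (cvg_unique hK (Fcvg (principal_ultra x))) => W /nbhs_singleton Wfx.
exact/principal_filterP.
Qed.

End StoneCech.

(** * The semigroup of ultrafilters *)

Section StoneCechSemigroup.
Variable S : semigroupType.

(** The preimage of the basic set of [A] under the shift by [v] is the basic set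
    of [[set s | v [set t | A (s * t)]]], by definition of the product. *)
Lemma stone_cech_right_topological : right_topological (stone_cech S).
Proof.
by move=> v; apply: continuous_to_stone_cech => A; exact: open_stone_cech_base.
Qed.

Lemma principal_mul (x : S) (v : stone_cech S) (A : set S) :
  ultra_sets (principal_ultra x * v) A <-> v [set t | A (x * t)].
Proof. exact: principal_filterP. Qed.

Lemma principal_ultraM (x y : S) :
  principal_ultra (x * y) = principal_ultra x * principal_ultra y.
Proof.
apply: stone_cech_inj; apply/funext => A; apply/propext.
by rewrite principal_mul /= !principal_filterP.
Qed.

Lemma principal_ultra_center (x : S) :
  topological_center (stone_cech S) (principal_ultra x).
Proof.
apply: continuous_to_stone_cech => A.
have := @open_stone_cech_base S [set t | A (x * t)].
by congr (open _); apply/seteqP; split=> v /principal_mul.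
Qed.

(** The product of limits is reached in two passages to the limit, in the order
    in which the product of ultrafilters nests its quantifiers: right
    continuity of [H] moves [s] along [u] with [F v] fixed, and then the left
    shift by the central element [f s] moves [t] along [v]. *)
Lemma stone_cech_morph (H : topSemigroupType) (f : S -> H)
    (F : stone_cech S -> H) :
  right_topological H -> hausdorff_space H -> {morph f : x y / x * y} ->
  range f `<=` topological_center H ->
  (forall u, fmap f (ultra_sets u) --> F u) ->
  {morph F : u v / u * v}.
Proof.
move=> rH hH fM fH Fcvg u v.
have PF := fmap_proper_filter f (stone_cech_proper (u * v)).
apply: (cvg_unique hH (Fcvg (u * v))) => W.
rewrite nbhsE => -[O [oO Ouv] OW].
have Osv : nbhs (F u) [set a | O (a * F v)].
  by apply: rH; exact: open_nbhs_nbhs.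
apply: (@filterS _ u _ _ _ _ (Fcvg u _ Osv)) => s /= {}Osv.
have Ost : nbhs (F v) [set b | O (f s * b)].
  by apply: (fH (f s)); [exists s|exact: open_nbhs_nbhs].
apply: (@filterS _ v _ _ _ _ (Fcvg v _ Ost)) => t /= {}Ost.
by rewrite fM; exact: OW.
Qed.

End StoneCechSemigroup.

Lemma principal_ultra1 (G : groupType) (u : stone_cech G) :
  principal_ultra 1 * u = u /\ u * principal_ultra 1 = u.
Proof.
split; apply: stone_cech_inj; apply/funext => A; apply/propext.
  rewrite principal_mul; suff -> : [set t | A (1 * t)] = A by [].
  by apply/seteqP; split=> t /=; rewrite mul1g.
rewrite /= /ultra_mul_sets /=.
suff -> : [set s | principal_filter 1 [set t | A (s * t)]] = A by [].
by apply/seteqP; split=> s; rewrite /= principal_filterP /= mulg1.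
Qed.

(** * Quotients by closed congruences *)

Section CongruenceQuotient.
Variables (S : topSemigroupType) (rho : congruence S).
Local Notation Q := (congr_quot rho).
Local Notation cl := (congr_class rho).

Lemma congr_class_surj (q : Q) : exists x, cl x = q.
Proof. by exists (repr q); rewrite /congr_class reprK. Qed.

Lemma congr_classM : {morph cl : x y / x * y}.
Proof. by move=> x y; rewrite -congr_quot_mulE. Qed.

Lemma congr_class_continuous : continuous cl.
Proof. exact: pi_continuous. Qed.

Lemma congr_quot_continuous (Z : topologicalType) (f : Q -> Z) :
  continuous (f \o cl) -> continuous f.
Proof. by move=> fc; apply/quotient_continuous. Qed.

Lemma congr_quot_right_topological : right_topological S -> right_topological Q.
Proof.
move=> rS q; have [s <-] := congr_class_surj q; apply: congr_quot_continuous.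
rewrite (_ : _ \o _ = cl \o (fun x => x * s)).
  move=> x; apply: continuous_comp; [exact: rS|exact: congr_class_continuous].
by apply/funext => x /=; rewrite congr_classM.
Qed.

Lemma congr_class_center (s : S) :
  topological_center S s -> topological_center Q (cl s).
Proof.
move=> sc; apply: congr_quot_continuous.
rewrite (_ : _ \o _ = cl \o (fun x => s * x)).
  move=> x; apply: continuous_comp; [exact: sc|exact: congr_class_continuous].
by apply/funext => x /=; rewrite congr_classM.
Qed.

Lemma congr_quot_compact : compact [set: S] -> compact [set: Q].
Proof.
move=> cS; rewrite (_ : [set: Q] = cl @` setT).
  apply: continuous_compact cS.
  exact: continuous_subspaceT congr_class_continuous.
by apply/seteqP; split=> // q _; have [x <-] := congr_class_surj q; exists x.
Qed.

(** The saturation of [C] is the projection of the compact set of the pairs in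
    [rho] whose first component is in [C]. *)
Lemma congr_class_closed_map (C : set S) :
  compact [set: S] -> hausdorff_space S -> closed rho -> closed C ->
  closed (cl @` C).
Proof.
move=> cS hS clrho clC.
have -> : closed (cl @` C) = closed (cl @^-1` (cl @` C)).
  by rewrite -!openC.
have -> : cl @^-1` (cl @` C) = snd @` (rho `&` fst @^-1` C).
  apply/seteqP; split=> [y [x Cx /congr_classP xy]|_ [[x y] [/= xy Cx] <-]].
    by exists (x, y).
  by exists x => //; exact/congr_classP.
apply: continuous_closed_map => //.
- by rewrite -setXTT; exact: compact_setX.
- by move=> [x y]; exact: cvg_snd.
apply: closedI => //; apply: preimage_closed => // -[x y] _; exact: cvg_fst.
Qed.

Lemma congr_quot_hausdorff :
  compact [set: S] -> hausdorff_space S -> closed rho -> hausdorff_space Q.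
Proof.
move=> cS hS clrho; apply: (hausdorff_closed_image (f := cl)) => //.
- exact: congr_class_continuous.
- exact: congr_class_surj.
- by move=> C; exact: congr_class_closed_map.
Qed.

Lemma congr_quot_lift (H : topSemigroupType) (F : S -> H) :
  continuous F -> {morph F : x y / x * y} ->
  (forall x y, rho (x, y) -> F x = F y) ->
  exists g : Q -> H,
    [/\ continuous g, {morph g : x y / x * y} & forall x, g (cl x) = F x].
Proof.
move=> cF FM Frho.
have gE x : F (repr (cl x)) = F x by apply: Frho; exact: congr_repr.
exists (fun q => F (repr q)); split=> //.
  apply: congr_quot_continuous; rewrite (_ : _ \o _ = F) //.
  by apply/funext => x /=.
move=> p q; have [x <-] := congr_class_surj p.
have [y <-] := congr_class_surj q.
by rewrite -congr_classM !gE FM.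
Qed.

End CongruenceQuotient.

Lemma kernel_congruence (S H : topSemigroupType) (F : S -> H) :
  hausdorff_space H -> continuous F -> {morph F : x y / x * y} ->
  closed_congruence [set p : S * S | F p.1 = F p.2].
Proof.
move=> hH cF FM; split.
  split=> //= [x y z -> //|a1 b1 a2 b2 ab1 ab2].
  by rewrite !FM ab1 ab2.
apply: closed_equalizer => // -[x y].
  by apply: (@continuous_comp _ _ _ fst F); [exact: cvg_fst|exact: cF].
by apply: (@continuous_comp _ _ _ snd F); [exact: cvg_snd|exact: cF].
Qed.

(** * Groups among semigroups *)

Lemma left_inverse_group (S : semigroupType) (e : S) :
  left_id e *%g -> right_id e *%g -> (forall x : S, exists y, y * x = e) ->
  semigroup_is_group S.
Proof.
move=> e1 e2 li; exists e; split=> // x; have [y yx] := li x; exists y.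
split=> //; have [z zy] := li y.
by rewrite -[x]e1 -zy -(mulgA z) yx e2 zy.
Qed.

Lemma group_idem_eq (S : semigroupType) (x y : S) :
  semigroup_is_group S -> x * x = x -> y * y = y -> x = y.
Proof.
move=> [e [e1 e2 inv]].
suff idem1 z : z * z = z -> z = e by move=> /idem1 -> /idem1 ->.
by move=> zz; have [t [tz _]] := inv z; rewrite -tz -{2}zz mulgA tz e1.
Qed.

(** * The universal chartification *)

Section Theta.
Variable G : groupType.

Lemma Theta_idem (u : stone_cech G) :
  u * u = u -> congr_class (Theta G) u = h_Theta 1.
Proof. by move=> uu; apply/congr_classP => rho [_]; apply. Qed.

Lemma Theta_min (rho : set (stone_cech G * stone_cech G)) :
  closed_congruence rho ->
  (forall u, u * u = u -> rho (u, principal_ultra 1)) ->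
  forall u v, Theta G (u, v) -> rho (u, v).
Proof.
move=> crho irho u v; apply; split=> // -[x y] [/= xx ->]; exact: irho.
Qed.

(** An idempotent of the closed left ideal generated by [u] has the form
    [v * u]; it becomes the unit, so the class of [v] is a left inverse. *)
Lemma congr_quot_Theta_group : semigroup_is_group (congr_quot (Theta G)).
Proof.
apply: (@left_inverse_group _ (h_Theta 1)) => q;
  have [u <-] := congr_class_surj q.
- by rewrite -congr_classM (principal_ultra1 u).1.
- by rewrite -congr_classM (principal_ultra1 u).2.
have [|||e [v _ <-] ee] :=
  @ellis_numakura (stone_cech G) (range (fun v => v * u))
  (@stone_cech_right_topological G) (@stone_cech_compact G)
  (@stone_cech_hausdorff G).
- apply: continuous_closed_map => //; first exact: stone_cech_compact.
    exact: stone_cech_hausdorff.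
  exact: stone_cech_right_topological.
- by exists (u * u), u.
- by move=> _ _ [v _ <-] [w _ <-]; exists (v * u * w) => //; rewrite !mulgA.
by exists (congr_class _ v); rewrite -congr_classM Theta_idem.
Qed.

Lemma h_Theta_dense : dense (range (@h_Theta G)).
Proof.
move=> O [q Oq] oO; have [u uq] := congr_class_surj q.
have [||v [Ov [x _ xv]]] :=
  @principal_ultra_dense G (congr_class (Theta G) @^-1` O).
- by exists u; rewrite /= uq.
- by move/continuousP: (@congr_class_continuous _ (Theta G)); exact.
by exists (h_Theta x); split; [rewrite /h_Theta xv|exists x].
Qed.

Lemma h_Theta_center :
  range (@h_Theta G) `<=` topological_center (congr_quot (Theta G)).
Proof.
by move=> _ [x _ <-]; apply: congr_class_center; exact: principal_ultra_center.
Qed.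

Lemma chart_group_Theta : chart_group (congr_quot (Theta G)).
Proof.
have cS := @stone_cech_compact G; have hS := @stone_cech_hausdorff G.
split.
- exact: congr_quot_Theta_group.
- exact/congr_quot_right_topological/stone_cech_right_topological.
- apply: congr_quot_hausdorff => //.
  by have [] := smallest_closed_congruenceP
    [set p : stone_cech G * stone_cech G |
      p.1 * p.1 = p.1 /\ p.2 = principal_ultra 1].
- exact: congr_quot_compact.
move=> O O0 oO; have [x [Ox xG]] := h_Theta_dense O0 oO.
by exists x; split=> //; exact: h_Theta_center.
Qed.

End Theta.

Theorem theorem2p9 (G : discreteGroupType) :
  @universal_chartification G (congr_quot (Theta G)) (@h_Theta G).
Proof.
split.
- exact: chart_group_Theta.
- by apply/continuousP => A _; exact: discrete_open.
- by move=> x y; rewrite /h_Theta principal_ultraM congr_classM.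
- exact: h_Theta_dense.
- exact: h_Theta_center.
move=> H f [gH rH hH cH _] _ fM fcenter.
have [F [cF Fcvg Ff]] := stone_cech_extension f cH hH.
have FM := stone_cech_morph rH hH fM fcenter Fcvg.
have FTheta u v : Theta G (u, v) -> F u = F v.
  apply: (Theta_min (kernel_congruence hH cF FM)) => w ww /=.
  apply: group_idem_eq => //; first by rewrite -FM ww.
  by rewrite -FM -principal_ultraM mulg1.
have [g [cg gM gF]] := congr_quot_lift cF FM FTheta.
by exists g; split=> //; apply/funext => x /=; rewrite gF Ff.
Qed.
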